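(* Let $\mathbb{K}$ be a field. For every integer $d>1$ there exist a polynomial ring $\mathbb{K}[x_1,\dots,x_n]$ and a finite family $\mathcal{F}=\{f_1,\dots,f_k\}$ of polynomials in it with $\max_i\deg(f_i)\leq \mathrm{d}_{\mathrm{reg}}(\mathcal{F})$ such that $\mathrm{d}_{\mathrm{reg}}(\mathcal{F})=d$ and, for every degree-compatible term order $\sigma$, $\mathrm{sd}_{\sigma}(\mathcal{F})=d+1$.
   Context: $\mathbb{K}$ is an arbitrary field (not necessarily finite), and $(\mathcal{F})$ denotes the ideal of $\mathbb{K}[x_1,\dots,x_n]$ generated by $\mathcal{F}$. For a nonzero polynomial $p$, $p^{\mathrm{top}}$ is the homogeneous part of largest degree of $p$. For an ideal $\mathcal{I}$, $\mathcal{I}_d$ is the set of homogeneous polynomials of degree $d$ in $\mathcal{I}$ (including $0$). Degree of regularity: $\mathrm{d}_{\mathrm{reg}}(\mathcal{F})$ is the smallest integer $d\ge 0$ for which $(\mathcal{F}^{\mathrm{top}})_d=(\mathbb{K}[x_1,\dots,x_n])_d$, where $\mathcal{F}^{\mathrm{top}}=\{f_1^{\mathrm{top}},\dots,f_k^{\mathrm{top}}\}$ and $(\mathcal{F}^{\mathrm{top}})$ is the ideal it generates; if no such $d$ exists, $\mathrm{d}_{\mathrm{reg}}(\mathcal{F})=+\infty$. For an integer $d$, $V_{\mathcal{F},d}$ is the smallest $\mathbb{K}$-linear subspace of $\mathbb{K}[x_1,\dots,x_n]$ (with respect to inclusion) such that (i) $\{f\in\mathcal{F}:\deg(f)\leq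 d\}\subseteq V_{\mathcal{F},d}$, and (ii) for every monomial $m$ and every $f\in V_{\mathcal{F},d}$ with $\deg(mf)\leq d$, one has $mf\in V_{\mathcal{F},d}$. A term order is degree-compatible if $\deg(m)<\deg(m')$ implies that $m$ is smaller than $m'$. Solving degree: for a degree-compatible term order $\sigma$, $\mathrm{sd}_{\sigma}(\mathcal{F})$ is the smallest $d$ for which $V_{\mathcal{F},d}$ contains a Gröbner basis of the ideal $(\mathcal{F})$ with respect to $\sigma$. *)

(* Defs.v *)
From mathcomp Require Import all_boot all_order all_algebra.
From mathcomp.multinomials Require Import mpoly.
From Stdlib Require Import ClassicalEpsilon.

Set Implicit Arguments.
Unset Strict Implicit.
Unset Printing Implicit Defensive.

Import GRing.Theory.
Local Open Scope ring_scope.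

(* Values in N u {+oo} are encoded in [option nat], with [None] for +oo;
   [least P] is then the minimum of P, and +oo when P is empty. *)
Definition is_least (P : nat -> Prop) (d : nat) : Prop :=
  P d /\ forall e : nat, P e -> (d <= e)%N.

Definition least (P : nat -> Prop) : option nat :=
  match excluded_middle_informative (exists d, is_least P d) with
  | left h => Some (proj1_sig (constructive_indefinite_description _ h))
  | right _ => None
  end.

Definition le_inf (a : nat) (b : option nat) : Prop :=
  match b with Some b' => (a <= b')%N | None => True end.

Lemma least_SomeP (P : nat -> Prop) (d : nat) :
  least P = Some d <-> is_least P d.
Proof.
rewrite /least; case: excluded_middle_informative => [h|nh].
  case: constructive_indefinite_description => d' [Pd' le_d'] /=.
  split=> [[<-] //|[Pd le_d]]; congr Some.
  by apply/eqP; rewrite eqn_leq le_d' // le_d.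
by split=> // leastd; case: nh; exists d.
Qed.

Lemma least_NoneP (P : nat -> Prop) :
  least P = None <-> forall d : nat, ~ P d.
Proof.
rewrite /least; case: excluded_middle_informative => [h|nh].
  by split=> // noP; have [d [Pd _]] := h; case: (noP d).
split=> // _ d; elim/ltn_ind: d => d IHd Pd; case: nh; exists d; split=> // e Pe.
by rewrite leqNgt; apply/negP => lt_ed; apply: (IHd e).
Qed.

Section Polynomials.

Variables (K : fieldType) (n : nat).
Implicit Types (p q f : {mpoly K[n]}) (F G : seq {mpoly K[n]}).

(* Total degree. The zero polynomial gets degree 0 here instead of -oo; since
   degrees are only bounded above, by natural numbers, this is harmless. *)
Definition tdeg p : nat := (msize p).-1.

Definition top p : {mpoly K[n]} := pihomog mdeg (tdeg p) p.

Definition ideal_gen (S : {mpoly K[n]} -> Prop) p : Prop :=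
  exists2 s : seq ({mpoly K[n]} * {mpoly K[n]}),
    (forall c, c \in s -> S c.2) & p = \sum_(c <- s) c.1 * c.2.

Definition ideal_of F : {mpoly K[n]} -> Prop := ideal_gen (fun f => f \in F).

Definition hpart (I : {mpoly K[n]} -> Prop) (d : nat) p : Prop :=
  I p /\ p \is d.-homog.

Definition dreg F : option nat :=
  least (fun d => forall p,
    hpart (ideal_of (map top F)) d p <-> hpart (fun=> True) d p).

Definition subspace (W : {mpoly K[n]} -> Prop) : Prop :=
  W 0 /\ forall (a : K) p q, W p -> W q -> W (a *: p + q).

Definition Vclosed F (d : nat) (W : {mpoly K[n]} -> Prop) : Prop :=
  [/\ subspace W,
      forall f, f \in F -> (tdeg f <= d)%N -> W f
    & forall (m : 'X_{1..n}) f,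
        W f -> (tdeg ('X_[m] * f) <= d)%N -> W ('X_[m] * f)].

Definition Vspace F (d : nat) p : Prop :=
  forall W : {mpoly K[n]} -> Prop, Vclosed F d W -> W p.

Lemma Vspace_closed F d : Vclosed F d (Vspace F d).
Proof.
split; first split.
- by move=> W [[]].
- move=> a p q Vp Vq W cW; case: (cW) => -[_ lin] _ _.
  by apply: lin; [apply: Vp | apply: Vq].
- by move=> f Ff df W [_ gen _]; apply: gen.
- by move=> m f Vf df W cW; case: (cW) => _ _ mul; apply: mul => //; apply: Vf.
Qed.

(* [sigma m1 m2] means that m1 is smaller than or equal to m2. *)
Definition term_order (sigma : rel 'X_{1..n}) : Prop :=
  [/\ reflexive sigma, antisymmetric sigma, transitive sigma & total sigma] /\
  (forall m, sigma 0%MM m) /\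
  (forall m m1 m2, sigma m1 m2 -> sigma (m + m1)%MM (m + m2)%MM).

Definition degree_compatible (sigma : rel 'X_{1..n}) : Prop :=
  forall m1 m2, (mdeg m1 < mdeg m2)%N -> sigma m1 m2 && (m1 != m2).

Definition is_lead (sigma : rel 'X_{1..n}) p (m : 'X_{1..n}) : Prop :=
  m \in msupp p /\ forall m', m' \in msupp p -> sigma m' m.

Definition initial_ideal (sigma : rel 'X_{1..n}) (S : {mpoly K[n]} -> Prop) :
    {mpoly K[n]} -> Prop :=
  ideal_gen (fun q => exists f m, [/\ S f, is_lead sigma f m & q = 'X_[m]]).

Definition groebner_basis (sigma : rel 'X_{1..n})
    (I : {mpoly K[n]} -> Prop) G : Prop :=
  (forall g, g \in G -> I g) /\
  (forall p, initial_ideal sigma (fun g => g \in G) p <->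
             initial_ideal sigma I p).

Definition solving_degree (sigma : rel 'X_{1..n}) F : option nat :=
  least (fun d => exists2 G : seq {mpoly K[n]},
    (forall g, g \in G -> Vspace F d g) &
    groebner_basis sigma (ideal_of F) G).

End Polynomials.

(* Main.v *)
Require Import Defs.
From mathcomp Require Import all_boot all_order all_algebra.
From mathcomp.multinomials Require Import mpoly.
From mathcomp Require Import ring zify.
Import GRing.Theory.
Local Open Scope ring_scope.

(** In two variables [x] and [y], let the family consist of all monomials of
    degree [d], with [1] subtracted from the two pure powers [x^d] and [y^d].
    The top parts are exactly the monomials of degree [d], which generate all
    forms of degree [d] and no nonzero form of smaller degree; hence the degree of
    regularity is [d] ([dreg_family]).

    The ideal of the family is the whole ring.  As [d > 1], the monomial
    [x^(d-1) y] is not a pure power; it and [x^d - 1] yield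
      [y = x * (x^(d-1) y) - y * (x^d - 1)],
    whence [y^d] and finally [1 = y^d - (y^d - 1)] ([one_in_ideal]).  A Groebner
    basis of the unit ideal must contain a nonzero constant, whatever the term
    order ([groebner_unit_const]), so the solving degree is the first degree in
    which [1] can be derived.  The computation above stays within degree [d + 1]
    ([one_in_Vspace]).  In degree [d], the generators have nothing to be
    multiplied by: their span contains no nonzero polynomial of degree less than
    [d], so it is already closed, and it contains no nonzero constant
    ([balanced_closed]). *)

(** * Monomials and homogeneous parts *)

Definition monomials_of_degree (n d : nat) : seq 'X_{1..n} :=
  [seq m <- [seq bmnm m | m : 'X_{1..n < d.+1}] | mdeg m == d].

Lemma mem_monomials_of_degree (n d : nat) (m : 'X_{1..n}) :
  (m \in monomials_of_degree n d) = (mdeg m == d).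
Proof.
rewrite mem_filter andb_idr // => /eqP md.
have lt_md : (mdeg m < d.+1)%N by rewrite md.
by apply/mapP; exists (BMultinom lt_md); rewrite ?mem_enum.
Qed.

Lemma homog_mul_coef_low (K : fieldType) (n d : nat) (c t : {mpoly K[n]})
    (m : 'X_{1..n}) :
  t \is d.-homog -> (mdeg m < d)%N -> (c * t)@_m = 0.
Proof.
move=> homt ltmd; rewrite mcoeffM big1 // => k /eqP def_m.
have deg_m : (mdeg k.2 <= mdeg m)%N by rewrite [leqRHS](congr1 mdeg def_m) mdegD leq_addl.
by rewrite (dhomog_nemf_coeff homt) ?mulr0 // ltn_eqF // (leq_ltn_trans deg_m).
Qed.

Lemma ideal_gen_low_coef (K : fieldType) (n d : nat)
    (S : {mpoly K[n]} -> Prop) (p : {mpoly K[n]}) (m : 'X_{1..n}) :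
  (forall t, S t -> t \is d.-homog) -> ideal_gen S p -> (mdeg m < d)%N ->
  p@_m = 0.
Proof.
move=> homS [s Ss ->] ltmd; rewrite raddf_sum big_seq big1 // => c /Ss Sc.
by apply: homog_mul_coef_low ltmd; apply: homS.
Qed.

Lemma tdeg_mulX (K : fieldType) (n : nat) (m : 'X_{1..n}) (f : {mpoly K[n]}) :
  (tdeg ('X_[m] * f) <= mdeg m + tdeg f)%N.
Proof.
have [->|nzf] := eqVneq f 0; first by rewrite mulr0 /tdeg msize0.
have nzX : 'X_[m] != 0 :> {mpoly K[n]} by rewrite -msize_poly_eq0 msizeX.
rewrite /tdeg msizeM // msizeX; move: nzf; rewrite -msize_poly_eq0.
by case: (msize f) => // k _; rewrite addSn addnS.
Qed.

(** * Groebner bases of the unit ideal *)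

Lemma ideal_gen_one (K : fieldType) (n : nat) (S : {mpoly K[n]} -> Prop) p :
  S 1 -> ideal_gen S p.
Proof.
by move=> S1; exists [:: (p, 1)]; rewrite ?big_seq1 ?mulr1 // => c /[1!inE] /eqP->.
Qed.

Lemma initial_ideal_one (K : fieldType) (n : nat) (sigma : rel 'X_{1..n})
    (S : {mpoly K[n]} -> Prop) p :
  term_order sigma -> S 1 -> initial_ideal sigma S p.
Proof.
move=> [[refl _ _ _] _] S1; apply: ideal_gen_one; exists 1, 0%MM.
by split; rewrite ?mpolyX0 //; split=> [|m']; rewrite msupp1 inE // => /eqP->.
Qed.

Lemma groebner_one (K : fieldType) (n : nat) (sigma : rel 'X_{1..n})
    (I : {mpoly K[n]} -> Prop) :
  term_order sigma -> I 1 -> groebner_basis sigma I [:: 1].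
Proof.
move=> ts I1; split=> [g /[1!inE] /eqP-> //|p].
by split=> _; apply: initial_ideal_one; rewrite ?inE.
Qed.

(** The constant coefficient of a combination of monomials vanishes unless one
    of them is trivial, and only constants have the least monomial as leading
    monomial. *)
Lemma groebner_unit_const (K : fieldType) (n : nat) (sigma : rel 'X_{1..n})
    (I : {mpoly K[n]} -> Prop) (G : seq {mpoly K[n]}) :
  term_order sigma -> I 1 -> groebner_basis sigma I G ->
  exists2 c : K, c != 0 & c%:MP \in G.
Proof.
move=> ts I1 [_ /(_ 1)[_ /(_ (initial_ideal_one _ _ _ _ _ ts I1))[s Ss one]]].
have [[c cs c0]|no_unit] :
    (exists2 c, c \in s & c.2@_0%MM != 0) \/ (forall c, c \in s -> c.2@_0%MM = 0).
- case: (boolP (has (fun c => c.2@_0%MM != 0) s)) => [/hasP|/hasPn h]; first by left.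
  by right=> c /h /negPn /eqP.
- have [f [m [Gf [mf leadm] def_c]]] := Ss c cs.
  move: c0; rewrite def_c mcoeffX; case: (m =P 0%MM) => [m0 _|_]; last by rewrite eqxx.
  subst m.
  have [[_ anti _ _] [min _]] := ts.
  have supp m : m \in msupp f -> m = 0%MM.
    by move=> /leadm le_m0; apply: anti; rewrite le_m0 min.
  exists f@_0%MM; first by rewrite mcoeff_eq0 negbK.
  suff <- : f = (f@_0%MM)%:MP by [].
  apply/mpolyP => m; rewrite mcoeffC.
  have [->|nm0] := eqVneq m 0%MM; first by rewrite mulr1.
  rewrite mulr0; apply/eqP; rewrite mcoeff_eq0; apply: contra nm0.
  by move=> /supp /eqP.
- have := congr1 (mcoeff 0%MM) one; rewrite mcoeff1 eqxx raddf_sum big_seq big1.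
    by move/eqP; rewrite oner_eq0.
  by move=> c /no_unit c0; rewrite /= mcoeff0_is_multiplicative c0 mulr0.
Qed.

(** * The family *)

Definition xpow (d : nat) : 'X_{1..2} := (U_(ord0) *+ d)%MM.
Definition ypow (d : nat) : 'X_{1..2} := (U_(ord_max) *+ d)%MM.

Definition pure_power (d : nat) (m : 'X_{1..2}) : bool :=
  (m == xpow d) || (m == ypow d).

Definition gen (K : fieldType) (d : nat) (m : 'X_{1..2}) : {mpoly K[2]} :=
  'X_[m] - ((pure_power d m)%:R)%:MP.

Definition family (K : fieldType) (d : nat) : seq {mpoly K[2]} :=
  [seq gen K d m | m <- monomials_of_degree 2 d].

Lemma mdeg_xpow (d : nat) : mdeg (xpow d) = d.
Proof. by rewrite mdegMn mdeg1 mul1n. Qed.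

Lemma mdeg_ypow (d : nat) : mdeg (ypow d) = d.
Proof. by rewrite mdegMn mdeg1 mul1n. Qed.

Lemma xpow_neq_ypow (d : nat) : (0 < d)%N -> xpow d != ypow d.
Proof.
move=> d0; apply/eqP => /mnmP /(_ ord0); rewrite !mulmnE !mnm1E /= mul1n mul0n.
by move=> d_eq0; rewrite d_eq0 in d0.
Qed.

Lemma familyP (K : fieldType) (d : nat) (f : {mpoly K[2]}) :
  reflect (exists2 m, mdeg m = d & f = gen K d m) (f \in family K d).
Proof.
apply: (iffP mapP) => [[m /[1!mem_monomials_of_degree] /eqP md ->]|[m /eqP md ->]].
  by exists m.
by exists m; rewrite ?mem_monomials_of_degree.
Qed.

Lemma gen_coef_deg (K : fieldType) (d : nat) (m m' : 'X_{1..2}) :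
  (0 < d)%N -> mdeg m' = d -> (gen K d m)@_m' = (m == m')%:R.
Proof.
move=> d0 md; rewrite mcoeffB mcoeffX mcoeffC -(mdeg_eq0 m') md eqn0Ngt d0 /=.
by rewrite mulr0 subr0.
Qed.

Lemma tdeg_gen (K : fieldType) (d : nat) (m : 'X_{1..2}) :
  (0 < d)%N -> mdeg m = d -> tdeg (gen K d m) = d.
Proof.
move=> d0 md; apply/eqP; rewrite eqn_leq /tdeg; apply/andP; split; last first.
  have : m \in msupp (gen K d m).
    by rewrite -[_ \in _]negbK -mcoeff_eq0 gen_coef_deg // eqxx oner_eq0.
  by move/msize_mdeg_lt; rewrite md; lia.
have := msizeD_le 'X_[m] (- ((pure_power d m)%:R%:MP : {mpoly K[2]})).
rewrite msizeN msizeX msizeC md => /leq_trans le_gen.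
have : (msize (gen K d m) <= d.+1)%N.
  by apply: le_gen; rewrite geq_max leqnn (leq_trans (leq_b1 _)).
by lia.
Qed.

Lemma top_gen (K : fieldType) (d : nat) (m : 'X_{1..2}) :
  (0 < d)%N -> mdeg m = d -> top (gen K d m) = 'X_[m].
Proof.
move=> d0 md; rewrite /top tdeg_gen // /gen pihomogB pihomogX /= md eqxx.
rewrite (@pihomog_ne0 _ _ _ 0%N) ?subr0 //; first by rewrite ltn_eqF.
by rewrite -[_%:R%:MP]mulr1 mul_mpolyC dhomogZ // dhomog1.
Qed.

(** * Degree of regularity *)

Lemma dreg_family (K : fieldType) (d : nat) :
  (0 < d)%N -> dreg (family K d) = Some d.
Proof.
move=> d0; apply/least_SomeP.
have tops t : t \in map (@top K 2) (family K d) -> t \is d.-homog.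
  by move=> /mapP[_ /familyP[m md ->] ->]; rewrite top_gen // dhomogX; apply/eqP.
split=> [p|e eqe].
  split=> [[_ homp] //|[_ homp]]; split=> //.
  exists [seq ((p@_m)%:MP, 'X_[m]) | m <- msupp p].
    move=> _ /mapP[m supp_m ->] /=; have md := dhomog_mf homp supp_m.
    by apply/mapP; exists (gen K d m); [apply/familyP; exists m | rewrite top_gen].
  by rewrite big_map /= {1}[p]mpolyE; apply: eq_bigr => m _; rewrite mul_mpolyC.
rewrite leqNgt; apply/negP => lt_ed.
(* In degree e < d the form x^e is not in the ideal. *)
have [_ [|Ix _]] := eqe 'X_[xpow e]; first by rewrite /hpart dhomogX /= mdeg_xpow.
have := ideal_gen_low_coef K 2 d _ _ (xpow e) tops Ix.
rewrite mdeg_xpow mcoeffX eqxx => /(_ lt_ed) /eqP.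
by rewrite oner_eq0.
Qed.

(** * Deriving the constant one *)

Lemma xpow_gen (K : fieldType) (d : nat) :
  gen K d (xpow d) = 'X_[xpow d] - 1.
Proof. by rewrite /gen /pure_power eqxx. Qed.

Lemma ypow_gen (K : fieldType) (d : nat) :
  gen K d (ypow d) = 'X_[ypow d] - 1.
Proof. by rewrite /gen /pure_power eqxx orbT. Qed.

Lemma mixed_gen (K : fieldType) (d : nat) : (1 < d)%N ->
  gen K d (xpow d.-1 + ypow 1)%MM = 'X_[xpow d.-1] * 'X_[ypow 1].
Proof.
move=> d1; rewrite /gen mpolyXD (_ : pure_power _ _ = false) ?subr0 //.
apply/negbTE/norP; split; apply/eqP => /mnmP.
  by move/(_ ord_max); rewrite mnmDE !mulmnE !mnm1E /=; lia.
by move/(_ ord0); rewrite mnmDE !mulmnE !mnm1E /=; lia.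
Qed.

Lemma pure_power_split (K : fieldType) (d : nat) : (0 < d)%N ->
  'X_[xpow d] = 'X_[xpow 1] * 'X_[xpow d.-1] :> {mpoly K[2]} /\
  'X_[ypow d] = 'X_[ypow d.-1] * 'X_[ypow 1] :> {mpoly K[2]}.
Proof.
case: d => // k _; rewrite -!mpolyXD /xpow /ypow !mulm1n.
by split; congr 'X_[_]; [apply: mulmS | apply: mulmSr].
Qed.

(** The difference in parentheses equals [y]; times [y^(d-1)] it gives [y^d]. *)
Lemma one_combination (K : fieldType) (d : nat) : (1 < d)%N ->
  1 = 'X_[ypow d.-1] * ('X_[xpow 1] * gen K d (xpow d.-1 + ypow 1)%MM
        - 'X_[ypow 1] * gen K d (xpow d)) - gen K d (ypow d).
Proof.
move=> d1; rewrite mixed_gen // xpow_gen ypow_gen.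
have [-> ->] := pure_power_split K d (ltnW d1).
by ring.
Qed.

Lemma gen_in_family (K : fieldType) (d : nat) : (0 < d)%N ->
  [/\ gen K d (xpow d) \in family K d, gen K d (ypow d) \in family K d
    & gen K d (xpow d.-1 + ypow 1)%MM \in family K d].
Proof.
move=> d0; split; apply/familyP; eexists; try exact: erefl.
- exact: mdeg_xpow.
- exact: mdeg_ypow.
- by rewrite mdegD mdeg_xpow mdeg_ypow addn1 prednK.
Qed.

Lemma one_in_ideal (K : fieldType) (d : nat) : (1 < d)%N ->
  ideal_of (family K d) 1.
Proof.
move=> d1; have [Fx Fy Fm] := gen_in_family K d (ltnW d1).
exists [:: ('X_[ypow d.-1] * 'X_[xpow 1], gen K d (xpow d.-1 + ypow 1)%MM);
           (- ('X_[ypow d.-1] * 'X_[ypow 1]), gen K d (xpow d));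
           (- 1, gen K d (ypow d))].
  by move=> c; rewrite !inE => /or3P[] /eqP->.
by rewrite !big_cons big_nil /= {1}(one_combination K d d1); ring.
Qed.

Lemma one_in_Vspace (K : fieldType) (d : nat) : (1 < d)%N ->
  Vspace (family K d) d.+1 1.
Proof.
move=> d1; have [Fx Fy Fm] := gen_in_family K d (ltnW d1).
have [[_ lin] gens mul] := Vspace_closed (family K d) d.+1.
have Vgen f : f \in family K d -> Vspace (family K d) d.+1 f.
  move=> Ff; apply: gens => //; have [m md ->] := familyP _ _ _ Ff.
  by rewrite tdeg_gen // ltnW.
have sub p q : Vspace (family K d) d.+1 p -> Vspace (family K d) d.+1 q ->
    Vspace (family K d) d.+1 (p - q).
  by move=> Vp Vq; rewrite addrC -scaleN1r; apply: lin.
have mul1 i f : f \in family K d ->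
    Vspace (family K d) d.+1 ('X_[U_(i)] * f).
  move=> Ff; apply: mul; first exact: Vgen.
  have [m md ->] := familyP _ _ _ Ff.
  by rewrite (leq_trans (tdeg_mulX _ _ _ _)) // mdeg1 tdeg_gen // ltnW.
have def_y : 'X_[xpow 1] * gen K d (xpow d.-1 + ypow 1)%MM
    - 'X_[ypow 1] * gen K d (xpow d) = 'X_[ypow 1].
  rewrite mixed_gen // xpow_gen; have [-> _] := pure_power_split K d (ltnW d1).
  by ring.
rewrite (one_combination K d d1); apply: (sub); last exact: Vgen.
(* The factor of y^(d-1) has degree 1 by cancellation, so the product has
   degree d. *)
apply: (mul).
  by apply: sub; rewrite /xpow /ypow mulm1n; apply: mul1.
rewrite def_y -(proj2 (pure_power_split K d (ltnW d1))) /tdeg msizeX mdeg_ypow.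
exact: leqnSn.
Qed.

(** * No constant in degree d *)

(** The span of the family, described by coefficients: only terms of degree [d]
    and a constant term, the latter balancing the two pure powers. *)
Definition balanced (K : fieldType) (d : nat) (p : {mpoly K[2]}) : Prop :=
  (forall m, m != 0%MM -> mdeg m != d -> p@_m = 0) /\
  p@_0%MM + p@_(xpow d) + p@_(ypow d) = 0.

Lemma balanced_gen (K : fieldType) (d : nat) (m : 'X_{1..2}) :
  (0 < d)%N -> mdeg m = d -> balanced K d (gen K d m).
Proof.
move=> d0 md; split=> [m' nz nd|].
  rewrite mcoeffB mcoeffX mcoeffC (negbTE nz) mulr0 subr0.
  by case: (m =P m') nd => [<-|//]; rewrite md eqxx.
rewrite (gen_coef_deg K d m (xpow d) d0 (mdeg_xpow d)).
rewrite (gen_coef_deg K d m (ypow d) d0 (mdeg_ypow d)).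
rewrite mcoeffB mcoeffX mcoeffC eqxx mulr1 -mdeg_eq0 md eqn0Ngt d0 sub0r.
rewrite -addrA addrC /pure_power; have := xpow_neq_ypow d d0.
case: (m =P xpow d) => [->|_]; first by move=> /negbTE->; rewrite addr0 subrr.
by rewrite add0r subrr.
Qed.

(** A nonzero balanced polynomial has a term of degree [d], so that a product
    of degree at most [d] with a monomial is a product with [1]. *)
Lemma balanced_closed (K : fieldType) (d : nat) :
  (0 < d)%N -> Vclosed (family K d) d (balanced K d).
Proof.
move=> d0; split.
- split=> [|a p q [p0 bp] [q0 bq]].
    by split=> [m _ _|]; rewrite !mcoeff0 ?addr0.
  split=> [m nz nd|]; first by rewrite linearP /= p0 // q0 // mulr0 addr0.
  rewrite !linearP /=.
  by rewrite -[RHS](mulr0 a) -bp -[RHS]addr0 -bq; ring.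
- by move=> f /familyP[m md ->] _; apply: balanced_gen.
move=> m f bf le_d.
case: (boolP (has (fun m' => mdeg m' == d) (msupp f))) => [/hasP[m' fm' /eqP md']|].
  have : (m' + m)%MM \in msupp ('X_[m] * f).
    by rewrite -[_ \in _]negbK -mcoeff_eq0 mulrC addmC mcoeffMX mcoeff_eq0 negbK.
  move/msize_mdeg_lt; rewrite mdegD md' => lt_size.
  have /eqP : mdeg m = 0%N by move: le_d; rewrite /tdeg; lia.
  by rewrite mdeg_eq0 => /eqP->; rewrite mpolyX0 mul1r.
move/hasPn => no_d.
have coef_d m' : mdeg m' = d -> f@_m' = 0.
  move=> md'; apply/eqP; rewrite mcoeff_eq0; apply/negP => /no_d.
  by rewrite md' eqxx.
have f0 : f = 0.
  apply/mpolyP => m'; rewrite mcoeff0; have [f_low f_bal] := bf.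
  have [md'|nd] := eqVneq (mdeg m') d; first exact: coef_d.
  have [->|nz] := eqVneq m' 0%MM; last exact: f_low.
  by move: f_bal; rewrite (coef_d _ (mdeg_xpow d)) (coef_d _ (mdeg_ypow d)) !addr0.
by rewrite f0 mulr0 -f0.
Qed.

(** A space closed in degree [d] is closed in every smaller degree [e], so the
    balanced polynomials bound all these spans at once. *)
Lemma no_const_in_Vspace (K : fieldType) (d e : nat) (c : K) :
  (0 < d)%N -> (e <= d)%N -> Vspace (family K d) e c%:MP -> c = 0.
Proof.
move=> d0 le_ed /(_ (balanced K d)) [|_].
  have [sub gens mul] := balanced_closed K d d0.
  split=> // [f Ff lef|m f bf lef]; [apply: gens|apply: mul] => //.
    exact: leq_trans lef le_ed.
  exact: leq_trans lef le_ed.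
rewrite !mcoeffC eqxx -!mdeg_eq0 mdeg_xpow mdeg_ypow eqn0Ngt d0 /=.
by rewrite mulr1 mulr0 !addr0.
Qed.

Theorem mainTheorem2 (K : fieldType) (d : nat) (hd : (1 < d)%N) :
  exists (n : nat) (F : seq {mpoly K[n]}),
    [/\ 0 \notin F,
        le_inf (\max_(f <- F) tdeg f) (dreg F),
        dreg F = Some d
      & forall sigma : rel 'X_{1..n},
          term_order sigma -> degree_compatible sigma ->
          solving_degree sigma F = Some d.+1].
Proof.
have d0 : (0 < d)%N := ltnW hd.
exists 2, (family K d); split.
- apply/negP => /familyP[m md /(congr1 (mcoeff m)) /eqP].
  by rewrite gen_coef_deg // mcoeff0 eqxx eq_sym oner_eq0.
- rewrite dreg_family //=; apply/bigmax_leqP_seq => f /familyP[m md ->] _.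
  by rewrite tdeg_gen.
- exact: dreg_family.
move=> sigma ts _; apply/least_SomeP; split.
  exists [:: 1]; last by apply: groebner_one => //; apply: one_in_ideal.
  by move=> g /[1!inE] /eqP->; apply: one_in_Vspace.
move=> e [G VG gbG]; rewrite ltnNge; apply/negP => le_ed.
have [c nzc Gc] := groebner_unit_const K 2 sigma _ G ts (one_in_ideal K d hd) gbG.
by move/eqP: nzc; apply; apply: no_const_in_Vspace d0 le_ed (VG _ Gc).
Qed.
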